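(* For every deterministic search algorithm there exists a family of graph search problems with admissible heuristics, with $n_{\mathrm{opt}}$ unbounded over the family, on which the algorithm expands $\Omega(2^{n_{\mathrm{opt}}})$ nodes.
   Context: A (black-box) graph search problem consists of a finite state space $\mathcal S$, a set of goal states $\mathcal S^*\subseteq\mathcal S$, an edge-cost function $c:\mathcal S\times\mathcal S\to[0,\infty]$, an initial state $s_{\mathrm{init}}$, and a heuristic $h:\mathcal S\to[0,\infty]$. The successors of $s$ are $\mathrm{succ}(s) = \{s' : c(s,s')<\infty\}$. A search algorithm accesses the graph only by expanding states, i.e. calling $\mathrm{succ}(s)$ (which reveals the successors of $s$ and the corresponding edge costs), and by evaluating $h$ and the goal test; each call of $\mathrm{succ}$ counts as one expansion (repeated expansions of a state count separately). Let $c^*(s',s)$ be the minimum cost of a path from $s'$ to $s$ (with $c^*(s,s)=0$), $g^*(s) = c^*(s_{\mathrm{init}}, s)$, $h^*(s)$ the minimum cost of a path from $s$ to a goal state, and $C^*$ the minimum cost of a path from $s_{\mathrm{init}}$ to a goal state. $h$ is admissible if $h(s)\le h^*(s)$ for all $s$. Define $\hat h(s) = \max_{s'\in\mathcal S}\{h(s') - c^*(s',s)\}$ and $n_{\mathrm{opt}} = |\{s : g^*(s) + \hat h(s) \le C^*\}|$. *)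

(* Defs.v *)
From HB Require Import structures.
From mathcomp Require Import all_boot all_order all_algebra.
From mathcomp Require Import all_classical all_reals ereal.
Set Implicit Arguments.
Unset Strict Implicit.
Unset Printing Implicit Defensive.
Import Order.TTheory GRing.Theory Num.Theory.
Local Open Scope classical_set_scope.
Local Open Scope ring_scope.
Local Open Scope ereal_scope.

Record search_problem (R : realType) := SearchProblem {
  state : finType;
  goals : {set state};
  cost : state -> state -> \bar R;
  s_init : state;
  heur : state -> \bar R;
  cost_ge0 : forall s t, 0 <= cost s t;
  heur_ge0 : forall s, 0 <= heur s
}.

Section Problem.
Variables (R : realType) (P : search_problem R).
Implicit Types (s t : state P) (q : seq (state P)).

Definition is_succ s t : bool := cost s t < +oo.

(* Following [path], a path is given by its source [s] and the sequence [q] of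
   the states visited after [s]; the empty [q] is the trivial path at [s]. *)
Definition path_cost s q : \bar R := \sum_(x <- pairmap (@cost R P) s q) x.

(* Costs are nonnegative and there are finitely many states, so the infima
   below are minima, except that they are +oo when there is no path. *)
Definition cstar s t : \bar R :=
  ereal_inf [set path_cost s q | q in [set q | path is_succ s q /\ last s q = t]].

Definition gstar s : \bar R := cstar (s_init P) s.

Definition hstar s : \bar R :=
  ereal_inf [set path_cost s q
            | q in [set q | path is_succ s q /\ last s q \in goals P]].

Definition Cstar : \bar R := hstar (s_init P).

Definition admissible : Prop := forall s, heur s <= hstar s.

Definition solvable : Prop := Cstar < +oo.

(* Since +oo - +oo = -oo in \bar R, a state s' from which s is unreachable
   contributes -oo, even when heur s' = +oo. *)
Definition hhat s : \bar R :=
  \big[Order.max/-oo]_(s' : state P) (heur s' - cstar s' s).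

Definition n_opt : nat := #|[pred s | gstar s + hhat s <= Cstar]|.

Definition is_solution q : Prop :=
  path is_succ (s_init P) q /\ last (s_init P) q \in goals P.

End Problem.

Inductive query (S : Type) :=
  | Expand of S
  | EvalHeur of S
  | TestGoal of S.

Inductive answer (R : realType) (S : Type) :=
  | Successors of seq (S * \bar R)
  | HeurValue of \bar R
  | GoalStatus of bool.
Arguments Successors {R S}.
Arguments HeurValue {R S}.
Arguments GoalStatus {R S}.

Inductive action (S : Type) :=
  | Ask of query S
  | Halt of option (seq S).
Arguments Halt {S}.

(* A deterministic search algorithm is given the initial state and chooses its
   next action as a function of the queries made so far and their answers.  It
   either makes a new query, or halts with a path out of the initial state
   (encoded as in [path_cost]) or with the report that it found none.
   The queried states are not required to have been generated before, nor is
   the set of states hidden: algorithms that only query states they have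
   generated are particular cases. *)
Definition algorithm (R : realType) :=
  forall S : finType, S -> seq (query S * answer R S) -> action S.

Section Run.
Variables (R : realType) (A : algorithm R) (P : search_problem R).

Definition reply (x : query (state P)) : answer R (state P) :=
  match x with
  | Expand s => Successors [seq (t, cost s t) | t <- enum (is_succ s)]
  | EvalHeur s => HeurValue (heur s)
  | TestGoal s => GoalStatus (s \in goals P)
  end.

Fixpoint history (n : nat) : seq (query (state P) * answer R (state P)) :=
  if n is m.+1 then
    let H := history m in
    if A (s_init P) H is Ask x then rcons H (x, reply x) else H
  else [::].

Definition is_expansion (e : query (state P) * answer R (state P)) : bool :=
  if e.1 is Expand _ then true else false.

(* +oo when the algorithm makes infinitely many expansions. *)
Definition expansions : \bar R :=
  ereal_sup (range (fun n => (count is_expansion (history n))%:R%:E)).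

Definition solves : Prop :=
  exists n q, A (s_init P) (history n) = Halt (Some q) /\ is_solution q.

End Run.

(* What makes an [algorithm] a search algorithm: it finds a solution of every
   problem that has one and whose heuristic is admissible.  The solution is not
   required to have minimum cost, so algorithms that return optimal solutions
   are covered. *)
Definition search_algorithm (R : realType) (A : algorithm R) : Prop :=
  forall P : search_problem R, admissible P -> solvable P -> solves A P.

(* Main.v *)
(* All edges have cost 0. From the initial state one reaches a clique of "hub"
   states and a large set of "doors"; exactly one door, the exit, leads to the
   goal. Every other door [j] has a private predecessor, the sentinel [j], with
   infinite heuristic value, so that its value of hhat is infinite as well:
   only the hubs, the exit and the goal contribute to n_opt. Heuristic values
   and goal tests are the same whichever door is the exit, and expanding a
   state can only tell whether one given door is the exit, so an adversary that
   keeps answering as if there were no exit forces the algorithm to examine all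
   doors but one. *)
Require Import Defs.
From mathcomp Require Import all_boot all_order all_algebra.
From mathcomp Require Import all_classical all_reals ereal.
Import Order.TTheory GRing.Theory Num.Theory.
Local Open Scope ring_scope.

(** Reduces each unreachability claim below to exhibiting a set of states closed under edges. *)
Lemma path_last_closed (T : Type) (e : rel T) (C : pred T) s q :
    (forall x y, C x -> e x y -> C y) ->
  C s -> path e s q -> C (last s q).
Proof.
move=> closedC; elim: q s => //= t q IHq s Cs /andP[est].
by apply: IHq; apply: closedC est.
Qed.

(** * Path costs and runs in arbitrary problems *)

Section SearchProblems.
Context {R : realType}.

Section Costs.
Variable P : search_problem R.
Implicit Types (s t : state P) (q : seq (state P)).

Lemma path_cost_ge0 s q : (0 <= path_cost s q)%E.
Proof.
rewrite /path_cost; elim: q s => [|t q IHq] s /=; first by rewrite big_nil.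
by rewrite big_cons adde_ge0 ?cost_ge0.
Qed.

Lemma cstar_ge0 s t : (0 <= cstar s t)%E.
Proof. by apply: le_ereal_inf_tmp => _ [q _ <-]; apply: path_cost_ge0. Qed.

Lemma hstar_ge0 s : (0 <= hstar s)%E.
Proof. by apply: le_ereal_inf_tmp => _ [q _ <-]; apply: path_cost_ge0. Qed.

Lemma cstar_le_path_cost s q :
  path (@is_succ R P) s q -> (cstar s (last s q) <= path_cost s q)%E.
Proof. by move=> sq; apply: ereal_inf_lbound; exists q. Qed.

Lemma hstar_le_path_cost s q :
    path (@is_succ R P) s q -> last s q \in goals P ->
  (hstar s <= path_cost s q)%E.
Proof. by move=> sq gq; apply: ereal_inf_lbound; exists q. Qed.

Lemma cstar_unreachable s t :
    (forall q, path (@is_succ R P) s q -> last s q <> t) ->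
  cstar s t = +oo%E.
Proof.
move=> noq; apply/eqP; rewrite -leye_eq; apply: le_ereal_inf_tmp => _ [q [sq qt] <-].
by case: (noq q sq).
Qed.

Lemma hstar_unreachable s :
    (forall q, path (@is_succ R P) s q -> last s q \notin goals P) ->
  hstar s = +oo%E.
Proof.
move=> noq; apply/eqP; rewrite -leye_eq; apply: le_ereal_inf_tmp => _ [q [sq qg] <-].
by have := noq q sq; rewrite qg.
Qed.

Lemma le_hhat s t : (heur t - cstar t s <= hhat s)%E.
Proof. exact: le_bigmax. Qed.

Lemma heur_le_hhat s : (heur s <= hhat s)%E.
Proof.
apply: le_trans (le_hhat s s); rewrite leeDl // oppe_ge0.
apply: le_trans (cstar_le_path_cost s [::] isT) _.
by rewrite /path_cost big_nil.
Qed.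

End Costs.

Section Runs.
Variables (A : algorithm R) (P : search_problem R).

Lemma history_halted o n m :
    A _ (s_init P) (history A P n) = Halt o -> (n <= m)%N ->
  history A P m = history A P n.
Proof.
move=> halt_n; elim: m => [|m IHm]; first by rewrite leqn0 => /eqP->.
rewrite leq_eqVlt => /predU1P[<- //|/IHm] /= ->.
by rewrite halt_n.
Qed.

Lemma le_expansions n :
  ((count (@is_expansion R P) (history A P n))%:R%:E <= expansions A P)%E.
Proof. by apply: ereal_sup_ubound; exists n. Qed.

End Runs.

(** * The door problems and their [n_opt] *)

Section Doors.
Variables (I J : finType) (j0 : J).

Definition door_state : finType := (I * bool + option J)%type.
Definition hub (j : J) : door_state := inr (Some j).
Definition goal : door_state := inr None.
Definition door (i : I) : door_state := inl (i, true).
Definition sentinel (i : I) : door_state := inl (i, false).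

(* [x = None] stands for the absence of an exit *)
Definition door_edge (x : option I) : rel door_state := fun s t =>
  match s, t with
  | inr (Some _), inr (Some _) | inr (Some _), inl (_, true) => true
  | inl (i, true), inr None => x == Some i
  | inl (i, false), inl (i', true) => (i' == i) && (x != Some i)
  | _, _ => false
  end.

Definition door_cost x s t : \bar R := if door_edge x s t then 0%E else +oo%E.

Definition door_heur (s : door_state) : \bar R :=
  if s is inl (_, false) then +oo%E else 0%E.

Fact door_cost_ge0 x s t : (0 <= door_cost x s t)%E.
Proof. by rewrite /door_cost; case: ifP. Qed.

Fact door_heur_ge0 s : (0 <= door_heur s)%E.
Proof. by case: s => [[? []]|?]; rewrite /= ?leey. Qed.

Definition door_problem (x : option I) : search_problem R :=
  @SearchProblem R door_state [set goal] (door_cost x) (hub j0) door_heur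
    (door_cost_ge0 x) door_heur_ge0.

Lemma is_succ_door x : @is_succ R (door_problem x) =2 door_edge x.
Proof. by move=> s t; rewrite /is_succ /= /door_cost; case: ifP; rewrite ?ltry ?ltxx. Qed.

Lemma path_cost_door x s q :
  path (door_edge x) s q -> path_cost (P := door_problem x) s q = 0%E.
Proof.
rewrite /path_cost; elim: q s => [|t q IHq] s /=; first by rewrite big_nil.
by case/andP=> st /IHq IH; rewrite big_cons IH /= /door_cost st adde0.
Qed.

Lemma cstar_door_le0 x s q :
    path (door_edge x) s q ->
  (cstar (P := door_problem x) s (last s q) <= 0)%E.
Proof.
move=> sq; rewrite -(path_cost_door _ _ _ sq) cstar_le_path_cost //.
by rewrite (eq_path (is_succ_door x)).
Qed.

(** Only sentinels have a nonzero heuristic, and none reaches the goal: a sentinel leads only to a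
    door that is not the exit, and the sentinel of the exit has no successor. *)
Lemma admissible_door x : admissible (door_problem x).
Proof.
case=> [[i []]|j]; try exact: hstar_ge0.
rewrite hstar_unreachable // => q; rewrite (eq_path (is_succ_door x)) => sq.
pose C (s : door_state) := if s is inl (i, b) then b ==> (x != Some i) else false.
suff: C (last (sentinel i) q) by rewrite inE; case: (last _ _).
apply: path_last_closed sq => // -[[i1 []]|[j|]] [[i2 []]|[j'|]] //=.
  by move=> /negPf->.
by move=> _ /andP[/eqP->].
Qed.

Lemma Cstar_door_le0 i : (Cstar (door_problem (Some i)) <= 0)%E.
Proof.
have pq : path (door_edge (Some i)) (hub j0) [:: door i; goal] by rewrite /= eqxx.
rewrite -(path_cost_door _ _ _ pq) hstar_le_path_cost ?inE //.
by rewrite (eq_path (is_succ_door _)).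
Qed.

Lemma solvable_door i : solvable (door_problem (Some i)).
Proof. exact: le_lt_trans (Cstar_door_le0 i) _. Qed.

(** No sentinel reaches a hub, so each sentinel contributes [+oo - +oo = -oo]; every other state has
    heuristic 0. *)
Lemma hhat_hub_le0 x j : (hhat (P := door_problem x) (hub j) <= 0)%E.
Proof.
apply: bigmax_le => // -[[i []]|j'] _ /=; rewrite ?sub0e ?oppe_le0 ?cstar_ge0 //.
rewrite cstar_unreachable => [|q]; first by rewrite addeNy leNye.
rewrite (eq_path (is_succ_door x)) => sq.
pose C (s : door_state) := if s is inr (Some _) then false else true.
suff: C (last (sentinel i) q) by case: (last _ _) => [[]|[]].
by apply: path_last_closed sq => // -[[i1 []]|[?|]] [[i2 []]|[?|]].
Qed.

Lemma hhat_door x i :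
  x != Some i -> hhat (P := door_problem x) (door i) = +oo%E.
Proof.
move=> xi; apply/eqP; rewrite -leye_eq; apply: le_trans (le_hhat (door_problem x) _ (sentinel i)).
have := cstar_door_le0 x (sentinel i) [:: door i]; rewrite /= eqxx xi => /(_ isT).
(* The bound by 0 excludes [+oo], the one value whose subtraction from [+oo] does not give [+oo]. *)
by case: (cstar _ _).
Qed.

Lemma n_opt_door_ge i : (#|J| <= n_opt (door_problem (Some i)))%N.
Proof.
rewrite /n_opt -(card_codom (f := hub)) => [|j j' [] //].
apply/subset_leq_card/fintype.subsetP => _ /codomP[j ->]; rewrite inE.
apply: (@le_trans _ _ 0%E); last exact: hstar_ge0.
by rewrite adde_le0 ?hhat_hub_le0 // (cstar_door_le0 _ _ [:: hub j]).
Qed.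

Lemma n_opt_door_le i : (n_opt (door_problem (Some i)) <= #|J|.+2)%N.
Proof.
rewrite -(card_codom (f := hub)) => [|j j' [] //].
apply: (@leq_trans #|[:: door i, goal & codom hub]|); last first.
  by rewrite !fintype.cardU1 addnA -add2n leq_add2r (leq_add (leq_b1 _) (leq_b1 _)).
apply/subset_leq_card/fintype.subsetP => s; rewrite inE.
apply: contraTT => sN; rewrite -ltNge.
(* An infinite [hhat] fails the test: [gstar s] is not [-oo] and [Cstar] is finite. *)
suff -> : hhat (P := door_problem (Some i)) s = +oo%E.
  rewrite addey; first exact: solvable_door.
  by rewrite gt_eqF // (lt_le_trans _ (cstar_ge0 _ _ _)).
case: s sN => [[j []]|[j|]]; rewrite !inE.
- move=> /norP[ji _]; apply: hhat_door; apply: contra ji => /eqP[->].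
  exact: eqxx.
- by move=> _; apply/eqP; rewrite -leye_eq; apply: (heur_le_hhat (door_problem (Some i)) (sentinel j)).
- by rewrite (codom_f hub j) !orbT.
- by rewrite eqxx orbT.
Qed.

(** * The adversary argument *)

Definition examined (u : query door_state) : option I :=
  if u is Expand (inl (i, _)) then Some i else None.

(** Only door [i] and sentinel [i] have successors that depend on whether [i] is the exit. *)
Lemma reply_door i u :
    examined u != Some i ->
  reply (P := door_problem (Some i)) u = reply (P := door_problem None) u.
Proof.
case: u => //= s si; rewrite /is_succ /=.
have -> // : door_cost (Some i) s = door_cost None s.
apply/funext => t; rewrite /door_cost; congr (if _ then _ else _).
case: s t si => [[j []]|[j|]] [[j' []]|[j'|]] //= ji.
  by rewrite eq_sym (negPf ji).
by rewrite [Some i == _]eq_sym ji.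
Qed.

Section Adversary.
Variable A : algorithm R.

Let H := history A (door_problem None).

Definition examined_doors (h : seq (query door_state * answer R door_state)) :=
  pmap (fun e => examined e.1) h.

Lemma size_examined_doors h :
  (size (examined_doors h) <= count (@is_expansion R (door_problem None)) h)%N.
Proof.
elim: h => //= -[[[[i b]|j]|s|s] a] h IHh //=.
exact: leq_trans IHh (leqnSn _).
Qed.

(** While [i] is unexamined, all answers agree with those given without an exit, so a deterministic
    algorithm makes the same next query. *)
Lemma history_door i n :
    i \notin examined_doors (H n) ->
  history A (door_problem (Some i)) n = H n.
Proof.
rewrite /H; elim: n => //= n IHn.
case Au: (A _ _ _) => [u|o].
  rewrite /examined_doors -cats1 pmap_cat mem_cat negb_or => /andP[/IHn -> ui].
  rewrite Au cats1 reply_door //.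
  by move: ui => /=; case: (examined u) => //= i'; rewrite inE eq_sym.
by move=> /IHn ->; rewrite Au.
Qed.

Lemma card_examined_doorsS n :
  (#|examined_doors (H n.+1)| <= #|examined_doors (H n)|.+1)%N.
Proof.
rewrite /H /=; case: (A _ _ _) => [u|o] //.
rewrite /examined_doors -cats1 pmap_cat /=; case: (examined u) => [i|] /=.
  rewrite (@eq_card _ _ [predU1 i & examined_doors (H n)]).
    by rewrite fintype.cardU1 -add1n leq_add2r leq_b1.
  by move=> i'; rewrite !inE mem_cat inE orbC.
by rewrite cats0.
Qed.

(** The only edge into the goal leaves the exit, so a path valid for two distinct exits never enters
    the goal. *)
Lemma common_solution_door i i' (q : seq door_state) :
    is_solution (P := door_problem (Some i)) q ->
  is_solution (P := door_problem (Some i')) q -> i = i'.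
Proof.
case; rewrite (eq_path (is_succ_door _)) => pq lq [].
rewrite (eq_path (is_succ_door _)) => pq' _; apply/eqP; apply: contraTT lq => ii'.
have {pq pq'} : path [rel s t | door_edge (Some i) s t && door_edge (Some i') s t]
    (hub j0) q by rewrite path_relI pq.
rewrite inE; apply: (path_last_closed _ _ (fun s => s != goal)) => //= s t.
case: s t => [[j []]|[j|]] [[j' []]|[j'|]] //= _ /andP[/eqP[ij] /eqP[i'j]].
by rewrite ij i'j eqxx in ii'.
Qed.

Hypothesis hA : search_algorithm A.

Lemma examine_all_but_one :
  (0 < #|I|)%N -> exists n, #|examined_doors (H n)| = #|I|.-1.
Proof.
move=> I_gt0; apply: contrapT => noN.
(* The count starts at 0 and grows by at most 1, so it cannot jump over the missed value. *)
have few n : (#|examined_doors (H n)| < #|I|.-1)%N.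
  elim: n => [|n IHn]; last first.
    rewrite ltn_neqAle (leq_trans (card_examined_doorsS n) IHn) andbT.
    by apply/eqP => En; apply: noN; exists n.+1.
  rewrite ltn_neqAle card0 leq0n andbT.
  by apply/eqP => E0; apply: noN; exists 0%N; rewrite card0.
have /choice[N haltN] i : exists n, exists q,
    A _ (hub j0) (history A (door_problem (Some i)) n) = Halt (Some q)
    /\ is_solution (P := door_problem (Some i)) q.
  exact: (hA (door_problem (Some i)) (admissible_door _) (solvable_door _)).
(* The problem without exit is unsolvable, so the run [H] need not halt a priori; by time [n] the
   runs for all exits have halted. *)
pose n := \max_i N i.
have [i [i' [iN i'N ii']]] : exists i i',
    [/\ i \notin examined_doors (H n), i' \notin examined_doors (H n) & i != i'].
  have : (1 < #|[predC examined_doors (H n)]|)%N.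
    apply: contraLR (few n); rewrite -!leqNgt -(cardC (mem (examined_doors (H n)))).
    by rewrite -subn1 leq_subLR addnC leq_add2r.
  by case/fintype.card_gt1P => i [i' [iN i'N ii']]; exists i, i'.
have haltH j : j \notin examined_doors (H n) -> exists2 q,
    A _ (hub j0) (H n) = Halt (Some q)
    & is_solution (P := door_problem (Some j)) q.
  move=> jN; have [q [haltq solq]] := haltN j; exists q => //.
  rewrite -(history_door _ _ jN).
  by rewrite (history_halted A (door_problem (Some j)) _ _ n haltq) ?leq_bigmax.
(* Both runs coincide with [H] up to time [n], hence return the same path, which would solve both
   problems. *)
have [q Aq solq] := haltH i iN; have [q' Aq' solq'] := haltH i' i'N.
move: solq'; rewrite Aq in Aq'; case: Aq' => <- /(common_solution_door _ _ _ solq).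
by move/eqP; apply/negP.
Qed.

Lemma expansions_door : (0 < #|I|)%N ->
  exists i, ((#|I|.-1)%:R%:E <= expansions A (door_problem (Some i)))%E.
Proof.
move=> I_gt0; have [n En] := examine_all_but_one I_gt0.
(* A door still unexamined at time [n] is made the exit; the run up to [n] is then unchanged. *)
have [i iN] : exists i, i \in [predC examined_doors (H n)].
  apply/fintype.card_gt0P; move: I_gt0 En.
  rewrite -(cardC (mem (examined_doors (H n)))).
  by case: #|[predC _]| => //; rewrite addn0; case: #|_| => // m _ /esym/n_Sn.
exists i; apply: le_trans (le_expansions _ _ n).
rewrite history_door // lee_fin ler_nat -En.
exact: leq_trans (card_size _) (size_examined_doors _).
Qed.

End Adversary.
End Doors.
End SearchProblems.

Theorem theorem5 (R : realType) (A : algorithm R) (hA : search_algorithm A) :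
  exists P : nat -> search_problem R,
    [/\ forall k, admissible (P k),
        forall k, solvable (P k),
        forall N : nat, exists k, (N <= n_opt (P k))%N
      & exists2 c : R, 0 < c &
          forall k, ((c * 2 ^+ n_opt (P k))%:E <= expansions A (P k))%E].
Proof.
(* Doors are exponentially many in the number [k.+1] of hubs, which is at least 1 to provide the
   initial state. *)
have exI k : exists i : 'I_(2 ^ k.+1),
    ((2 ^ k.+1).-1%:R%:E <=
       expansions A (door_problem 'I_(2 ^ k.+1) 'I_k.+1 ord0 (Some i)))%E.
  rewrite -[in X in X%:R](card_ord (2 ^ k.+1)).
  by apply: expansions_door; rewrite // card_ord expn_gt0.
pose i k := sval (cid (exI k)).
exists (fun k => door_problem _ 'I_k.+1 ord0 (Some (i k))); split.
- by move=> k; apply: admissible_door.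
- by move=> k; apply: solvable_door.
- move=> N; exists N; apply: leq_trans (n_opt_door_ge _ _ _ _).
  by rewrite card_ord.
(* Since [n_opt] is at most [k.+3], the left side is at most [2 ^ k], which is at most
   [2 ^ k.+1 - 1]. *)
exists (2 ^- 3) => [|k]; first by rewrite invr_gt0 exprn_gt0.
apply: le_trans (svalP (cid (exI k))); rewrite lee_fin.
apply: (@le_trans _ _ (2 ^- 3 * 2 ^+ k.+3)).
  rewrite ler_pM2l ?invr_gt0 ?exprn_gt0 // ler_eXn2l ?ltr1n //.
  by apply: leq_trans (n_opt_door_le _ _ _ _) _; rewrite card_ord.
rewrite -(addn3 k) exprD mulrCA mulVf ?expf_neq0 ?pnatr_eq0 // mulr1.
rewrite -natrX ler_nat -ltnS prednK ?expn_gt0 //.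
by rewrite ltn_exp2l.
Qed.
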